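(* There is an absolute constant $c_2$ such that for every integer $q\ge 1$ (and all sufficiently large $n$), $$r_e(\vec P_n,q+1)\ \le\ c_2\, n^{2q}(\log n)^2 .$$ Moreover, there is a number $N=\Theta(n^q\log n)$ such that a random tournament $T_N$ on $N$ vertices has, with probability tending to $1$ as $n\to\infty$, the property that every coloring of $E(T_N)$ with $q+1$ colors contains a monochromatic copy of $\vec P_n$.
   Context: An oriented graph is a directed graph with no loops, no parallel edges and no pair of antiparallel edges. A tournament is an oriented graph in which between every two distinct vertices there is an edge in exactly one direction; a random tournament on $N$ vertices orients each pair independently and uniformly at random. $\vec P_n$ denotes the directed path on $n$ vertices. $r_e(\vec P_n,r)$ (in oriented graphs) is the minimum number $m$ such that there is an oriented graph with $m$ edges for which every coloring of its edges with $r$ colors contains a monochromatic directed copy of $\vec P_n$. Logarithms are base $2$. *)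

(* Defs.v *)
From mathcomp Require Import all_boot all_order all_algebra.
From mathcomp Require Import all_classical all_reals all_analysis.

Set Implicit Arguments.
Unset Strict Implicit.
Unset Printing Implicit Defensive.

Import Order.TTheory GRing.Theory Num.Theory.

(* A digraph on V without parallel edges is its edge set E : {set V * V}.     *)
(* The case x = y of [oriented] excludes loops.                               *)
Definition oriented (V : finType) (E : {set V * V}) : bool :=
  [forall x, forall y, ((x, y) \in E) ==> ((y, x) \notin E)].

Definition tournament (V : finType) (E : {set V * V}) : bool :=
  oriented E &&
  [forall x, forall y, (x != y) ==> ((x, y) \in E) || ((y, x) \in E)].

Definition mono_edge (V : finType) (E : {set V * V}) (r : nat)
    (c : {ffun V * V -> 'I_r}) (k : 'I_r) : rel V :=
  fun x y => ((x, y) \in E) && (c (x, y) == k).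

(* The copy of the directed path on n vertices is listed by its vertices.     *)
Definition mono_path (V : finType) (E : {set V * V}) (n r : nat)
    (c : {ffun V * V -> 'I_r}) : bool :=
  [exists k : 'I_r, exists s : n.-tuple V,
     uniq s && sorted (mono_edge E c k) s].

(* A colouring of E is given by a map on all of V * V; its values outside E   *)
(* are never used.                                                            *)
Definition arrows (V : finType) (E : {set V * V}) (n r : nat) : bool :=
  [forall c : {ffun V * V -> 'I_r}, mono_path E n c].

Definition arrows_with (n r m : nat) : Prop :=
  exists (V : finType) (E : {set V * V}),
    [/\ oriented E, #|E| = m & arrows E n r].

Lemma arrows_transitive (n r : nat) :
  let E := [set p : 'I_(n ^ r).+1 * 'I_(n ^ r).+1 | (p.1 < p.2)%N] in
  oriented E /\ arrows E n r.
Proof.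
move=> E; split.
  apply/forallP => x; apply/forallP => y; apply/implyP.
  by rewrite !inE /= -leqNgt => /ltnW.
apply/forallP => c; apply: contraT => noP.
have noT (k : 'I_r) (s : n.-tuple 'I_(n ^ r).+1) :
    ~~ sorted (mono_edge E c k) s.
  apply: contra noP => ss; apply/existsP; exists k; apply/existsP; exists s.
  rewrite ss andbT; apply: (@sorted_uniq _ (fun x y : 'I_(n ^ r).+1 => (x < y)%N)).
  - by move=> ? ? ?; apply: ltn_trans.
  - by move=> ?; apply: ltnn.
  - by apply: sub_sorted ss => x y /andP[]; rewrite inE.
pose Q k v m := [exists s : m.-tuple 'I_(n ^ r).+1,
                  sorted (mono_edge E c k) (rcons s v)].
case: n => [|n] in E c noP noT Q *.
  by have := noT (c (ord0, ord0)) [tuple].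
pose L k v := \max_(m < n.+1 | Q k v m) (m : nat).
have LP k v : {m : 'I_n.+1 | Q k v m & L k v = m}.
  have Q0 : Q k v (ord0 : 'I_n.+1) by apply/existsP; exists [tuple].
  by rewrite /L (bigop.bigmax_eq_arg ord0) //; case: arg_maxnP => // m Qm _; exists m.
have Llt k v : (L k v < n)%N.
  have [m Qm ->] := LP k v; rewrite ltn_neqAle -ltnS ltn_ord andbT.
  apply: contraL Qm => /eqP mn; rewrite /Q mn; apply/existsPn => s.
  exact: (noT k [tuple of rcons s v]).
have Lmono k u v : mono_edge E c k u v -> (L k u < L k v)%N.
  move=> uv; have := Llt k u; have [m /existsP[s ss] ->] := LP k u => mn.
  have Qv : Q k v m.+1.
    apply/existsP; exists [tuple of rcons s u].
    rewrite [tval _]/(rcons s u); case: (tval s) ss => [|x t] /= ss.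
      by rewrite uv.
    by rewrite rcons_path ss last_rcons.
  exact: (@leq_bigmax_cond _ (fun i : 'I_n.+1 => Q k v i) (fun i => i : nat)
    (Ordinal (mn : (m.+1 < n.+1)%N)) Qv).
pose F (v : 'I_(n.+1 ^ r).+1) : {ffun 'I_r -> 'I_n.+1} :=
  [ffun k => inord (L k v)].
have FL k v : F v k = L k v :> nat by rewrite ffunE inordK // ltnW // ltnS Llt.
have Flt (u v : 'I_(n.+1 ^ r).+1) : (u < v)%N -> F u <> F v.
  move=> uv /ffunP/(_ (c (u, v)))/(congr1 val) /=; rewrite !FL => eqL.
  have : mono_edge E c (c (u, v)) u v by rewrite /mono_edge inE uv eqxx.
  by move/Lmono; rewrite eqL ltnn.
have injF : injective F.
  move=> u v Fuv; apply: val_inj; case: (ltngtP u v) => // uv.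
    by case: (Flt _ _ uv).
  by case: (Flt _ _ uv); rewrite -Fuv.
by have := leq_card F injF; rewrite card_ffun !card_ord ltnn.
Qed.

Lemma arrows_with_ex (n r : nat) : exists m, `[< arrows_with n r m >].
Proof.
have [oE aE] := arrows_transitive n r.
by eexists; apply/asboolP; do 2 eexists; split; [exact: oE | | exact: aE].
Qed.

(* r_e(P_n, r) for oriented graphs. *)
Definition size_ramsey (n r : nat) : nat := ex_minn (arrows_with_ex n r).

Local Open Scope ring_scope.

(* Probability of A for the random tournament on 'I_N: the pairs x < y are    *)
(* oriented independently, each orientation having probability 1/2.           *)
Definition tournament_prob (R : realType) (N : nat)
    (A : {set 'I_N * 'I_N} -> bool) : R :=
  \sum_(T : {set 'I_N * 'I_N} | tournament T && A T)
    \prod_(p : 'I_N * 'I_N | (p.1 < p.2)%N) (1 / 2).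

Definition log2 (R : realType) (x : R) : R := ln x / ln 2.

(* Main.v *)
Require Import Defs.
From mathcomp Require Import all_boot all_order all_algebra.
From mathcomp Require Import all_classical all_reals all_analysis.
From mathcomp Require Import fintype finset zify lra.
Import Order.TTheory GRing.Theory Num.Theory.
Import numFieldNormedType.Exports.

Set Implicit Arguments.
Unset Strict Implicit.
Unset Printing Implicit Defensive.

(* With high probability every two disjoint sets of k = O(log N) vertices of  *)
(* T_N are joined by an edge in each direction. By the Gallai-Roy theorem,    *)
(* q - 1 colours without a path on n vertices leave a set U of N / n^(q-1)    *)
(* vertices on which only two colours occur, so it remains to bound |U| by    *)
(* O(n log n) when neither of them has a path on n vertices.                  *)
(*   Depth-first search in both colours splits a set X into X1, X2 such that  *)
(* all edges from X1 to X2 have the second colour and all edges from X2 to X1 *)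
(* have the first; the vertices lost are of the order of the longest paths.   *)
(* Iterating gives chains of 2^i sets. Long paths inside the sets of a chain  *)
(* can be linked, so their lengths add up to O(n) and each of the log n       *)
(* rounds loses O(n) vertices. At the end there are n / log n sets, whose     *)
(* typical longest paths have length O(log n), so that they have only         *)
(* O(log^2 n) vertices, by Gallai-Roy in both colours.                        *)
(*   As k is about 2 q log n, a constant independent of q requires linking    *)
(* paths shorter than k: each set contributes t disjoint paths of the same    *)
(* length (see packing), and two families are linked as soon as t times the   *)
(* discarded length j exceeds 2 k.                                            *)

(** * Paths and depth-first search *)

Section Paths.
Variable V : finType.
Implicit Types (e : rel V) (X Y Z : {set V}) (s : seq V).

Definition dpath e X s := [&& uniq s, sorted e s & all (mem X) s].

Lemma dpath_take e X s m : dpath e X s -> dpath e X (take m s).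
Proof.
case/and3P=> us ss aX; apply/and3P; split.
- exact: take_uniq.
- exact: take_sorted.
- by apply/allP=> x /mem_take; apply: (allP aX).
Qed.

Lemma dpath_drop e X s m : dpath e X s -> dpath e X (drop m s).
Proof.
case/and3P=> us ss aX; apply/and3P; split.
- exact: drop_uniq.
- exact: drop_sorted.
- by apply/allP=> x /mem_drop; apply: (allP aX).
Qed.

Lemma dpath_sub e X Y s : X \subset Y -> dpath e X s -> dpath e Y s.
Proof.
move=> /subsetP XY /and3P[us ss aX]; apply/and3P; split=> //.
by apply/allP=> x /(allP aX) /XY.
Qed.

Lemma dpath_size e X s : dpath e X s -> size s <= #|X|.
Proof.
case/and3P=> us _ aX; rewrite cardE; apply: uniq_leq_size => // x /(allP aX).
by rewrite mem_enum.
Qed.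

(* Depth-first search: A is the set of exhausted vertices, s the current      *)
(* stack and B the set of unvisited vertices.                                 *)
Lemma dfs_split e X a :
    (forall s, dpath e X s -> size s <= a) ->
  exists A B : {set V}, [/\ A \subset X, B \subset X, [disjoint A & B],
    #|A| = #|B| & #|X| <= #|A| + #|B| + a] /\
    {in A & B, forall x y, ~~ e x y}.
Proof.
move=> Xa.
suff [A [B [s [AB sP pAB noE]]]] : exists (A B : {set V}) s, [/\ #|A| = #|B|,
    dpath e X s, perm_eq (enum A ++ s ++ enum B) (enum X)
    & {in A & B, forall x y, ~~ e x y}].
  exists A, B; split=> //.
  have := perm_uniq pAB; rewrite enum_uniq cat_uniq => /and3P[_ AsB _].
  split=> //.
  - by apply/subsetP => x xA; rewrite -mem_enum -(perm_mem pAB) mem_cat mem_enum xA.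
  - by apply/subsetP => x xA; rewrite -mem_enum -(perm_mem pAB) !mem_cat !mem_enum xA !orbT.
  - rewrite disjoint_subset; apply/subsetP => x xA; rewrite !inE.
    apply: contra AsB => xB; apply/hasP; exists x; last by rewrite /= mem_enum.
    by rewrite mem_cat mem_enum xB orbT.
  - have := perm_size pAB; rewrite !size_cat -!cardE => <-.
    by rewrite addnCA [leqLHS]addnC leq_add2l Xa.
(* Every move takes one vertex from [B] to the stack or from the stack to [A], so in [#|X|] moves
   [#|A| - #|B|] rises from [- #|X|] to 0. *)
suff H i : i <= #|X| -> exists (A B : {set V}) s, [/\ #|B| + i = #|A| + #|X|,
    dpath e X s, perm_eq (enum A ++ s ++ enum B) (enum X)
    & {in A & B, forall x y, ~~ e x y}].
  have [A [B [s [AB sP pAB noE]]]] := H _ (leqnn _).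
  by exists A, B, s; split=> //; lia.
elim: i => [_|i IH iX].
  exists set0, X, [::]; split=> //; first by rewrite cards0; lia.
    by rewrite enum_set0.
  by move=> x y; rewrite inE.
have [A [B [s [AB sP pAB noE]]]] := IH (ltnW iX).
have [b bB] : exists b, b \in B by apply/set0Pn; rewrite -card_gt0; lia.
have pX x : (x \in X) = [|| x \in A, x \in s | x \in B].
  by rewrite -mem_enum -(perm_mem pAB) !mem_cat !mem_enum.
have := perm_uniq pAB; rewrite enum_uniq cat_uniq => /and3P[_ AsB].
rewrite cat_uniq => /and3P[us sB _].
have notA x : x \in s ++ enum B -> x \notin A.
  move=> xs; apply: contra AsB => xA; apply/hasP; exists x => //=.
  by rewrite mem_enum.
have nots x : x \in B -> x \notin s.
  move=> xB; apply: contra sB => xs; apply/hasP; exists x => //=.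
  by rewrite mem_enum.
have push x : x \in B -> (s = [::] \/ exists y s', s = rcons s' y /\ e y x) ->
  exists (A B : {set V}) s, [/\ #|B| + i.+1 = #|A| + #|X|,
    dpath e X s, perm_eq (enum A ++ s ++ enum B) (enum X)
    & {in A & B, forall x y, ~~ e x y}].
  move=> xB sx; exists A, (B :\ x), (rcons s x); split.
  - by have := cardsD1 x B; rewrite xB; lia.
  - case/and3P: sP => _ ss sX; apply/and3P; split.
    + by rewrite rcons_uniq nots.
    + case: sx => [->//|[y [s' [-> yx]]]] in ss *.
      by case: s' ss => [|z s'] /=; rewrite ?yx // !rcons_path last_rcons yx => ->.
    + by rewrite all_rcons /= pX xB !orbT.
  - apply: perm_trans pAB; rewrite perm_cat2l -cats1 -catA perm_cat2l /=.
    apply: uniq_perm; rewrite /= ?enum_uniq ?andbT ?mem_enum ?inE ?eqxx //.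
    move=> z; rewrite !inE !mem_enum !inE; case: eqP => [->|//].
    by rewrite xB.
  - by move=> y z yA; rewrite inE => /andP[_]; apply: noE.
case/lastP: s => [|s v] in sP pAB pX AsB us sB notA nots push *.
  by apply: (push b) => //; left.
have [/existsP[w /andP[wB vw]]|/existsPn noB] := boolP [exists w, (w \in B) && e v w].
  by apply: (push w) => //; right; exists v, s.
have vA : v \notin A by apply: notA; rewrite mem_cat mem_rcons inE eqxx.
exists (v |: A), B, s; split.
- by rewrite cardsU1 vA; lia.
- by have := dpath_take (size s) sP; rewrite -cats1 take_size_cat.
- apply: perm_trans pAB; apply: (@perm_trans _ ((v :: enum A) ++ s ++ enum B)).
    rewrite perm_cat2r; apply: uniq_perm; rewrite /= ?enum_uniq ?mem_enum ?vA //.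
    by move=> z; rewrite mem_enum !inE mem_enum.
  by apply/permP => p; rewrite !count_cat -cats1 count_cat /=; lia.
- move=> x y; rewrite !inE => /orP[/eqP->|xA] yB; last exact: noE.
  by have := noB y; rewrite yB.
Qed.

End Paths.

(** * The Gallai-Roy theorem *)

Section GallaiRoy.
Variable V : finType.
Implicit Types (e : rel V) (X : {set V}) (F : {set V * V}) (s : seq V).

Let edge F : rel V := fun x y => (x, y) \in F.
Let acyclic F := [forall x, forall y, edge F x y ==> ~~ connect (edge F) y x].

Lemma connect_setU1 F a b x y : connect (edge ((a, b) |: F)) x y ->
  connect (edge F) x y \/ connect (edge F) x a /\ connect (edge F) b y.
Proof.
case/connectP => p; elim: p x => [x _ ->|z p IH x]; first by left.
rewrite [path _ _ _]/=  => /andP[xz zp] /(IH _ zp) {IH zp} H.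
have [Fxz|] := boolP (edge F x z).
  have xz' := connect1 Fxz.
  case: H => [zy|[za by_]]; first by left; apply: connect_trans zy.
  by right; split=> //; apply: connect_trans za.
rewrite {1}/edge => /negPf Fxz; move: xz; rewrite {1}/edge in_setU1 Fxz orbF.
by case/eqP=> aE bE; right; subst; case: H => [zy|[_ zy]]; split.
Qed.

(* The colour of v is the length of a longest path ending at v in a maximal   *)
(* acyclic set F of edges; an edge outside F closes a cycle with F, so it     *)
(* also joins vertices of different colours.                                  *)
Lemma gallai_roy e X n : (forall s, dpath e X s -> size s <= n) ->
  exists f : V -> nat, {in X, forall x, f x < n} /\
    {in X &, forall x y, x != y -> f x = f y -> ~~ e x y}.
Proof.
move=> Xn; pose P F := acyclic F &&
  [forall p in F, [&& p.1 \in X, p.2 \in X & e p.1 p.2]].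
have P0 : P set0.
  rewrite /P; apply/andP; split; last by apply/forall_inP => p; rewrite inE.
  by apply/forallP => x; apply/forallP => y; rewrite /edge inE.
have [F /maxsetP[/andP[acF /forall_inP sF] Fmax] _] := maxset_exists P0.
have {}acF x y : edge F x y -> connect (edge F) y x -> false.
  by move=> xy; move/forallP/(_ x)/forallP/(_ y): acF; rewrite xy => /negP.
pose Q v m := [exists s : m.-tuple V, dpath (edge F) X (rcons s v)].
pose L v := \max_(m < n | Q v m) m.
have Qn v m : Q v m -> m < n.
  case/existsP=> s /and3P[us ss sX].
  rewrite -(size_tuple s) -(size_rcons s v); apply: Xn; apply/and3P; split=> //.
  by apply: sub_sorted ss => x y /sF /and3P[].
have LP v : v \in X -> Q v (L v).
  move=> vX; have Q0 : Q v 0 by apply/existsP; exists [tuple]; rewrite /dpath /= vX.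
  have := Qn _ _ Q0; rewrite /L; case: (n) => // n' _.
  rewrite (bigop.bigmax_eq_arg ord0) //; by case: arg_maxnP.
have Lmax v m : Q v m -> m <= L v.
  move=> Qm; exact: (@leq_bigmax_cond _ (fun i : 'I_n => Q v i) (fun i => i : nat)
    (Ordinal (Qn _ _ Qm)) Qm).
have Lmono u v : edge F u v -> L u < L v.
  move=> uv; have /and3P[/= uX vX _] := sF _ uv.
  have /existsP[s /and3P[us ss sX]] := LP u uX.
  apply: Lmax; apply/existsP; exists [tuple of rcons s u].
  apply/and3P; split.
  - rewrite rcons_uniq us andbT; apply/negP => vs; apply: (notF (acF _ _ uv _)).
    case/splitPr Es: {1}_ / vs => [p1 p2]; rewrite Es in ss.
    have := cat_sorted2 ss => -[_ /= vp2]; apply/connectP; exists p2 => //.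
    by have := congr1 (last u) Es; rewrite last_rcons last_cat.
  - rewrite [tval _]/(rcons s u); case: (tval s) ss => [|x t] /=.
      by rewrite uv.
    by move=> ss; rewrite rcons_path last_rcons uv ss.
  - by rewrite all_rcons /= vX.
have Lconn u v : connect (edge F) u v -> u != v -> L u < L v.
  case/connectP=> p; elim: p u v => [|w p IH] u v /=; first by move=> _ ->; rewrite eqxx.
  case/andP=> /Lmono uw wp vE _; case: (eqVneq w v) => [<-//|wv].
  exact: ltn_trans uw (IH _ _ wp vE wv).
exists L; split=> [x xX|x y xX yX xy LE]; first exact: Qn (LP _ xX).
apply/negP => exy.
have nF : ~~ edge F x y by apply/negP => /Lmono; rewrite LE ltnn.
have nyx : ~~ connect (edge F) y x.
  by apply/negP => /Lconn; rewrite eq_sym xy LE ltnn => /(_ isT).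
(* No [F]-path leads from [y] to [x], so adding [(x, y)] creates no cycle; maximality then puts it
   in [F], against [nF]. *)
suff PF : P ((x, y) |: F).
  by have := Fmax _ PF (subsetUr _ _) => FE; move: nF; rewrite /edge -FE setU11.
apply/andP; split; last first.
  by apply/forall_inP => p; rewrite in_setU1 => /orP[/eqP->/=|/sF//]; rewrite xX yX.
apply/forallP => a; apply/forallP => b; apply/implyP => ab; apply/negP.
case/connect_setU1 => [ba|[bx ya]]; move: ab; rewrite /edge in_setU1.
  by case/orP => [/eqP[aE bE]|/acF/(_ ba)//]; move: nyx; rewrite -aE -bE ba.
case/orP => [/eqP[aE bE]|Fab]; first by move: nyx; rewrite -bE bx.
move: nyx; rewrite (connect_trans ya) // (connect_trans _ bx) //.
exact: connect1.
Qed.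

Lemma large_independent_set e X n : (forall s, dpath e X s -> size s <= n) ->
  exists2 U : {set V}, U \subset X /\ #|X| <= n * #|U| &
    {in U &, forall x y, x != y -> ~~ e x y}.
Proof.
case/gallai_roy=> f [fn fE]; case: n => [|n] in fn *.
  exists set0; last by move=> x y; rewrite inE.
  rewrite sub0set cards0; case: (set_0Vmem X) => [->|[x /fn//]].
  by rewrite cards0.
pose U i := [set x in X | inord (f x) == i :> 'I_n.+1].
have [i maxU] : {i | \max_i #|U i| = #|U i|} by apply: bigop.eq_bigmax; rewrite card_ord.
exists (U i) => [|x y]; last first.
  rewrite !inE => /andP[xX /eqP fx] /andP[yX /eqP fy] xy; apply: fE => //.
  by rewrite -(inordK (fn _ xX)) -(inordK (fn _ yX)) fx fy.
split; first by apply/subsetP=> x; rewrite inE => /andP[].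
rewrite -sum1_card (partition_big (fun x => inord (f x) : 'I_n.+1) predT) //=.
apply: (@leq_trans (\sum_(j < n.+1) #|U i|)); last by rewrite sum_nat_const card_ord.
apply: leq_sum => j _; rewrite -maxU -[X in _ <= X]/(\max_i #|U i|).
apply: leq_trans (leq_bigmax j); rewrite -sum1_card.
by under [leqRHS]eq_bigl do rewrite inE.
Qed.

End GallaiRoy.

(** * Families of disjoint paths *)

Section Packing.
Variable V : finType.
Implicit Types (e : rel V) (X Y Z : {set V}) (s p : seq V) (ps : seq (seq V)).

Definition path_family e X t a ps :=
  [/\ size ps = t, {in ps, forall p, size p = a /\ dpath e X p}
    & uniq (flatten ps)].

(** A robust substitute for the length of a longest path. The value 0 is always attained, by [t]
    empty paths. *)
Definition packing t e X : nat :=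
  \max_(a < #|V|.+1 | `[< exists ps, path_family e X t a ps >]) a.

Lemma packing_family t e X : exists ps, path_family e X t (packing t e X) ps.
Proof.
rewrite /packing (bigop.bigmax_eq_arg ord0).
  by case: arg_maxnP => [|i /asboolP //]; apply/asboolP; exists (nseq t [::]);
    split; rewrite ?size_nseq //; [move=> p /nseqP[->] | elim: t].
apply/asboolP; exists (nseq t [::]).
by split; rewrite ?size_nseq //; [move=> p /nseqP[->] | elim: t].
Qed.

Lemma packing_max t e X a ps : 0 < t -> path_family e X t a ps ->
  a <= packing t e X.
Proof.
move=> t0 fam; have aV : a < #|V|.+1.
  case: fam => st Hps _; case: ps st Hps => [|p ps] st Hps; first by rewrite -st in t0.
  have [<- pP] := Hps p (mem_head _ _).
  by rewrite ltnS (leq_trans (dpath_size pP)) ?max_card.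
apply: (@leq_bigmax_cond _ _ (fun i : 'I_#|V|.+1 => i : nat) (Ordinal aV)).
by apply/asboolP; exists ps.
Qed.

(** A longer path could be cut into [t] segments of [packing t e X + 1] vertices each. *)
Lemma dpath_packing t e X s : 0 < t -> dpath e X s -> size s < t * (packing t e X).+1.
Proof.
move=> t0 sP; rewrite ltnNge; apply/negP => sl.
suff [ps [fam _]] : exists ps, path_family e X t (packing t e X).+1 ps /\
    {subset flatten ps <= s}.
  by have := packing_max t0 fam; rewrite ltnn.
move: (packing _ _ _).+1 sl => a; elim: t {t0} s sP => [|t IH] s sP sl.
  by exists [::].
have [|ps [[st Hps ups] sub]] := IH (drop a s) (dpath_drop _ sP).
  by rewrite size_drop; lia.
exists (take a s :: ps); split; last first.
  by move=> x; rewrite mem_cat => /orP[/mem_take//|/sub/mem_drop].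
split=> /=; first by rewrite st.
  move=> p; rewrite inE => /orP[/eqP->|/Hps //]; split; last exact: dpath_take.
  by rewrite size_takel //; lia.
have us : uniq (take a s ++ drop a s) by rewrite cat_take_drop; case/and3P: sP.
move: us; rewrite !cat_uniq => /and3P[-> ns _]; rewrite ups andbT /=.
by apply: contra ns => /hasP[x /sub xd xt]; apply/hasP; exists x.
Qed.

Lemma size_family e X t a ps : path_family e X t a ps -> size (flatten ps) = t * a.
Proof.
case=> <- Hps _; elim: ps Hps => [|p ps IH] Hps //=.
rewrite size_cat mulSn IH => [|q qps]; last by apply: Hps; rewrite inE qps orbT.
by have [-> _] := Hps p (mem_head _ _).
Qed.

(** Delete disjoint paths on [packing t e X + 1] vertices greedily; there cannot be [t] of them.
    Unlike in [dpath_packing], the factor [t] is paid in deleted vertices and not in path length. *)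
Lemma packing_remove t e X : 0 < t -> exists Z, [/\ Z \subset X,
  #|X| <= #|Z| + t * (packing t e X).+1 &
  forall s, dpath e Z s -> size s <= packing t e X].
Proof.
move=> t0; set a := packing t e X.
suff H r : (exists ps, path_family e X r a.+1 ps) \/ exists Z, [/\ Z \subset X,
  #|X| <= #|Z| + r * a.+1 & forall s, dpath e Z s -> size s <= a].
  by have [[ps /(packing_max t0)]|//] := H t; rewrite ltnn.
elim: r => [|r [[ps [sps Hps ups]]|[Z [ZX XZ HZ]]]].
- by left; exists [::].
- pose Z := X :\: [set x in flatten ps].
  have cZ : #|X| <= #|Z| + r * a.+1.
    rewrite -(cardsID [set x in flatten ps] X) addnC leq_add2l.
    apply: leq_trans (subset_leq_card (subsetIr _ _)) _.
    rewrite cardsE; apply: leq_trans (card_size _) _.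
    by rewrite (@size_family e X r a.+1).
  have [[s [sP sa]]|noP] := pselect (exists s, dpath e Z s /\ a < size s).
    left; exists (take a.+1 s :: ps); split=> /=; first by rewrite sps.
      move=> p; rewrite inE => /orP[/eqP->|/Hps //]; rewrite size_takel //; split=> //.
      by apply: dpath_take; apply: dpath_sub sP; apply: subsetDl.
    have /and3P[us _ /allP sZ] := sP.
    rewrite cat_uniq take_uniq // ups andbT /=; apply/hasPn => x xps.
    apply/negP => /mem_take /sZ /=.
    by rewrite !inE xps.
  right; exists Z; split; [exact: subsetDl | by lia |].
  by move=> s sP; rewrite leqNgt; apply/negP => sa; apply: noP; exists s.
- by right; exists Z; split=> //; lia.
Qed.

End Packing.

Lemma subseq_flatten (T : eqType) (g : seq T -> seq T) (P : pred (seq T)) ps :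
  (forall p, subseq (g p) p) ->
  subseq (flatten [seq g p | p <- ps & P p]) (flatten ps).
Proof.
move=> gP; elim: ps => //= p ps IH; case: (P p) => /=; first exact: cat_subseq.
exact: (cat_subseq (sub0seq p) IH).
Qed.

(** * Linking paths along a chain of sets *)

Section Chain.
Variables (V : finType) (e : rel V) (R : rel {set V}) (k t j : nat).
Hypothesis R_disjoint : forall X Y, R X Y -> [disjoint X & Y].
Hypothesis R_edge : forall X Y A B : {set V}, R X Y -> A \subset X -> B \subset Y ->
  k <= #|A| -> k <= #|B| -> exists x y, [/\ x \in A, y \in B & e x y].
Hypotheses (k_gt0 : 0 < k) (tj : 2 * k <= t * j).

Let avoids (cs : seq {set V}) (s : seq V) :=
  forall Z z, Z \in cs -> z \in Z -> z \notin s.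

(** The bound [l] does not count [y]. The path [s] may be empty, which is how a chain is started. *)
Let enters (cs : seq {set V}) l y := exists s,
  [/\ uniq s, sorted e (rcons s y), l <= size s & avoids cs s].

Let reach_ends Y cs l : (forall Z, Z \in cs -> R Y Z) ->
  (forall B : {set V}, B \subset Y -> k <= #|B| -> exists2 y, y \in B & enters (Y :: cs) l y) ->
  2 * j < packing t e Y ->
  exists2 E : {set V}, E \subset Y /\ k <= #|E| &
    forall x, x \in E -> exists s, [/\ uniq (rcons s x), sorted e (rcons s x),
      l + (packing t e Y - 2 * j) <= size (rcons s x) & avoids cs (rcons s x)].
Proof.
move=> RY entY; have [ps fam] := packing_family t e Y.
set a := packing t e Y in fam * => aj; have [sps Hps ups] := fam.
pose ok p := `[< exists2 y, y \in take j p & enters (Y :: cs) l y >].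
have card_pieces (g : seq V -> seq V) P : (forall p, subseq (g p) p) ->
    {in ps, forall p, size (g p) = j} ->
    #|[set x in flatten [seq g p | p <- ps & P p]]| = j * count P ps.
  move=> gs gj; rewrite cardsE (card_uniqP _); last first.
    exact: subseq_uniq (subseq_flatten _ _ gs) ups.
  elim: (ps) gj => [|p qs IH] gj /=; first by rewrite muln0.
  case: ifP => _ /=; rewrite ?size_cat IH ?gj ?mem_head ?mulnDr ?muln1 //;
  by move=> q qqs; rewrite gj // inE qqs orbT.
have sub_pieces (g : seq V -> seq V) P : (forall p, subseq (g p) p) ->
    [set x in flatten [seq g p | p <- ps & P p]] \subset Y.
  move=> gs; apply/subsetP => x; rewrite inE => /flattenP[_ /mapP[p pin ->]].
  move: pin; rewrite mem_filter => /andP[_ /Hps[_ /and3P[_ _ /allP pY]]] /(mem_subseq (gs p)).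
  exact: pY.
(* The first [j] vertices of the paths that cannot be entered contain no entry point, so together
   they number fewer than [k]. *)
have bad : j * count (predC ok) ps < k.
  rewrite -(card_pieces (take j)); first last.
  - by move=> p /Hps[pa _]; rewrite size_takel // pa; lia.
  - by move=> p; apply: take_subseq.
  rewrite ltnNge; apply/negP => /(entY _ (sub_pieces _ _ (fun p => take_subseq p j))) [y].
  rewrite inE => /flattenP[_ /mapP[p pin ->]] yp ent.
  move: pin; rewrite mem_filter => /andP[/= /asboolPn nok _].
  by apply: nok; exists y.
exists [set x in flatten [seq drop (a - j) p | p <- ps & ok p]].
  split; first by apply: sub_pieces => p; apply: drop_subseq.
  rewrite card_pieces; last first.
  - by move=> p /Hps[pa _]; rewrite size_drop pa; lia.
  - by move=> p; apply: drop_subseq.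
  have := count_predC ok ps; rewrite sps => st.
  move: tj bad; rewrite -st mulnDl ![_ * j]mulnC.
  by move: (j * count ok ps) (j * count _ ps) => u w; lia.
move=> x; rewrite inE => /flattenP[_ /mapP[p pin ->]] xp.
move: pin; rewrite mem_filter => /andP[/asboolP[y yp [s [us ss sl sav]]]].
move=> /Hps[pa /and3P[up sp /allP pY]].
pose i := index y p; pose i' := index x p.
have xinp := mem_drop xp; have yinp := mem_take yp.
have ij : i < j.
  by have := index_ltn yp.
have i'j : a - j <= i'.
  rewrite leqNgt; apply/negP => i'a; have : x \in take (a - j) p by rewrite in_take.
  move: up; rewrite -{1}(cat_take_drop (a - j) p) cat_uniq => /and3P[_ /hasPn ns _].
  by move/negP: (ns _ xp).
have i'p : i' < size p by rewrite index_mem.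
pose seg := drop i (take i' p).
have segE : rcons seg x = drop i (take i'.+1 p).
  rewrite (take_nth x) // nth_index // drop_rcons // size_takel; lia.
have seg_head : rcons seg x = y :: drop i.+1 (take i'.+1 p).
  rewrite segE (drop_nth y) ?size_takel //; last by lia.
  by rewrite nth_take ?nth_index //; lia.
have segY z : z \in rcons seg x -> z \in Y.
  by rewrite segE => /mem_drop/mem_take/pY.
exists (s ++ seg); rewrite rcons_cat; split.
- rewrite cat_uniq us segE drop_uniq ?take_uniq // andbT /= -segE.
  by apply/hasPn => z /segY; apply: sav; rewrite mem_head.
- have : sorted e (rcons seg x) by rewrite segE drop_sorted ?take_sorted.
  case: (s) ss => [|z s'] //=; rewrite seg_head -cat_rcons cat_path last_rcons => -> /=.
  by [].
- rewrite size_cat segE size_drop size_takel // leq_add //.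
  by move: (i) (i') ij i'j => i0 i1; lia.
- move=> Z z Zcs zZ; rewrite mem_cat negb_or (sav Z) ?inE ?Zcs ?orbT //=.
  apply/negP => /segY zY; have := R_disjoint (RY _ Zcs).
  by move/pred0P/(_ z); rewrite /= zY zZ.
Qed.

(** Induction along the chain. The invariant is that in each remaining set all but fewer than [k]
    vertices can be entered by a path on [l] vertices. A set with a packing of at most [2 * j]
    contributes 0 and is bypassed. *)
Let chain_path_from cs l : pairwise R cs ->
  (exists s, [/\ uniq s, sorted e s & l <= size s]) ->
  (forall (Y B : {set V}), Y \in cs -> B \subset Y -> k <= #|B| ->
     exists2 y, y \in B & enters cs l y) ->
  exists s, [/\ uniq s, sorted e s
    & l + \sum_(X <- cs) (packing t e X - 2 * j) <= size s].
Proof.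
elim: cs l => [|Y cs IH] l; first by rewrite big_nil addn0.
rewrite pairwise_cons big_cons => /andP[/allP RY Rcs] ps ent.
have [aj|aj] := leqP (packing t e Y) (2 * j).
  rewrite (eqP (_ : packing t e Y - 2 * j == 0)) ?subn_eq0 // add0n.
  apply: IH => // Z B Zcs BZ kB.
  have [|y yB [s [us ss sl sav]]] := ent Z B _ BZ kB; first by rewrite inE Zcs orbT.
  exists y => //; exists s; split=> // Z' z Z'cs; apply: sav.
  by rewrite inE Z'cs orbT.
have [|E [EY kE] HE] := @reach_ends Y cs l RY _ aj.
  by move=> B; apply: ent; rewrite mem_head.
rewrite addnA; apply: IH => // [|Z B Zcs BZ kB].
  have /set0Pn[x /HE[s [us ss sl _]]] : E != set0.
    by rewrite -card_gt0 (leq_trans k_gt0).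
  by exists (rcons s x).
have [x [y [/HE[s [us ss sl sav]] yB xy]]] := R_edge (RY _ Zcs) EY BZ kE kB.
exists y => //; exists (rcons s x); split=> //.
case: s ss {us sl sav} => [|z s] /=; first by rewrite xy.
by move=> ss; rewrite rcons_path ss last_rcons.
Qed.

(* 2k <= t j is what lets paths of consecutive sets be linked while losing    *)
(* only 2j vertices per set: each set carries t disjoint paths, and as long   *)
(* as half of them are reached, their last j vertices form a set of size k,   *)
(* which sends an edge to the first j vertices of half of the next paths.     *)
Lemma chain_path cs : pairwise R cs ->
  exists s, [/\ uniq s, sorted e s
    & \sum_(X <- cs) (packing t e X - 2 * j) <= size s].
Proof.
move=> Rcs; apply: (@chain_path_from cs 0 Rcs); first by exists [::].
move=> Y B _ _ kB; have /set0Pn[y yB] : B != set0.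
  by rewrite -card_gt0 (leq_trans k_gt0).
by exists y => //; exists [::].
Qed.

End Chain.

(** * Two colours *)

Lemma pairwise_rev (T : Type) (r : rel T) s :
  pairwise r (rev s) = pairwise (fun x y => r y x) s.
Proof. by elim: s => //= x s IH; rewrite rev_cons pairwise_rcons IH all_rev. Qed.

Lemma sum_seq_const (T : Type) (s : seq T) c : \sum_(x <- s) c = size s * c.
Proof. by rewrite big_const_seq count_predT iter_addn_0 mulnC. Qed.

Section TwoColours.
Variables (V : finType) (e1 e2 : rel V) (U : {set V}) (k : nat).
Hypothesis k_gt0 : 0 < k.
Hypothesis semicomplete : {in U &, forall x y, x != y ->
  [|| e1 x y, e2 x y, e1 y x | e2 y x]}.
Hypothesis pseudorandom : forall A B : {set V}, A \subset U -> B \subset U ->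
  [disjoint A & B] -> k <= #|A| -> k <= #|B| ->
  exists x y, [/\ x \in A, y \in B & e1 x y || e2 x y].

(** Given pseudorandomness, paths of [e2] can be linked along an [R]-chain forwards and paths of
    [e1] backwards. *)
Let R : rel {set V} := fun X Y => [&& X \subset U, Y \subset U, [disjoint X & Y] &
  [forall x in X, forall y in Y, ~~ e1 x y && ~~ e2 y x]].

Let R_sub (X Y X' Y' : {set V}) : X' \subset X -> Y' \subset Y -> R X Y -> R X' Y'.
Proof.
move=> X'X Y'Y /and4P[XU YU XY /forall_inP noE]; apply/and4P; split.
- exact: subset_trans XU.
- exact: subset_trans YU.
- exact: disjointWl X'X (disjointWr Y'Y XY).
- apply/forall_inP => x /(subsetP X'X) /noE /forall_inP Hx.
  by apply/forall_inP => y /(subsetP Y'Y) /Hx.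
Qed.

(* If e1 has no edge from A to B and e2 none from C to D, then A :&: C sends  *)
(* no edge at all to B :&: D, so one of these two sets has less than k        *)
(* vertices; hence A :&: D and B :&: C nearly exhaust X.                      *)
Lemma two_colour_split (X : {set V}) a b : X \subset U ->
    (forall s, dpath e1 X s -> size s <= a) ->
    (forall s, dpath e2 X s -> size s <= b) ->
  exists X1 X2 : {set V}, [/\ X1 \subset X, X2 \subset X, R X1 X2,
    2 * #|X1| <= #|X| /\ 2 * #|X2| <= #|X|
    & #|X| <= #|X1| + #|X2| + (2 * k + 2 * a + 2 * b)].
Proof.
move=> XU /dfs_split[A [B [[AX BX AB cAB XAB] noAB]]].
move=> /dfs_split[C [D [[CX DX CD cCD XCD] noCD]]].
have cardU (Y Z : {set V}) : [disjoint Y & Z] -> #|Y :|: Z| = #|Y| + #|Z|.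
  by move=> YZ; rewrite cardsU disjoint_setI0 // cards0 subn0.
have XAB' : #|X :\: (A :|: B)| <= a.
  by rewrite cardsD (setIidPr _) ?subUset ?AX // cardU //; lia.
have XCD' : #|X :\: (C :|: D)| <= b.
  by rewrite cardsD (setIidPr _) ?subUset ?CX // cardU //; lia.
have capAB (Y : {set V}) : Y \subset X -> #|Y| <= #|A :&: Y| + #|B :&: Y| + a.
  move=> YX; rewrite -(cardsID (A :|: B) Y) leq_add //; last first.
    by apply: leq_trans XAB'; apply/subset_leq_card/setSD.
  by rewrite setIC setIUl; apply: leq_card_setU.
have capCD (Y : {set V}) : Y \subset X -> #|Y| <= #|Y :&: C| + #|Y :&: D| + b.
  move=> YX; rewrite -(cardsID (C :|: D) Y) leq_add //; last first.
    by apply: leq_trans XCD'; apply/subset_leq_card/setSD.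
  by rewrite setIUr; apply: leq_card_setU.
have small : #|A :&: C| < k \/ #|B :&: D| < k.
  rewrite !ltnNge; apply/orP; rewrite -negb_and; apply/negP => /andP[kAC kBD].
  have [|||||x [y [xAC yBD]]] := @pseudorandom (A :&: C) (B :&: D).
  - by rewrite (subset_trans _ XU) // subIset ?AX.
  - by rewrite (subset_trans _ XU) // subIset ?BX.
  - exact: disjointWl (subsetIl _ _) (disjointWr (subsetIl _ _) AB).
  - by [].
  - by [].
  - move: xAC yBD; rewrite !inE => /andP[xA xC] /andP[yB yD].
    by rewrite (negPf (noAB _ _ xA yB)) (negPf (noCD _ _ xC yD)).
exists (A :&: D), (B :&: C); split.
- by rewrite subIset ?AX.
- by rewrite subIset ?BX.
- apply/and4P; split.
  + by rewrite (subset_trans _ XU) // subIset ?AX.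
  + by rewrite (subset_trans _ XU) // subIset ?BX.
  + exact: disjointWl (subsetIl _ _) (disjointWr (subsetIl _ _) AB).
  + apply/forall_inP => x; rewrite inE => /andP[xA xD].
    apply/forall_inP => y; rewrite inE => /andP[yB yC].
    by rewrite noAB // noCD.
- have AX' : #|A| + #|B| <= #|X|.
    by rewrite -cardU // subset_leq_card // subUset AX.
  have := subset_leq_card (subsetIl A D); have := subset_leq_card (subsetIl B C).
  by lia.
(* [A] and [C] each fill about half of [X]. If [A :&: C] is small, [A :&: D] nearly fills [A] and
   [B :&: C] nearly fills [C]; if [B :&: D] is small, the same holds with [D] and [B]. *)
- have := capAB _ CX; have := capAB _ DX; have := capCD _ AX; have := capCD _ BX.
  by case: small; lia.
Qed.

Variables (n : nat).
Hypothesis no_path1 : forall s, uniq s -> sorted e1 s -> size s < n.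
Hypothesis no_path2 : forall s, uniq s -> sorted e2 s -> size s < n.

(** The path linked by [chain_path] has fewer than [n] vertices; the [2 * j] vertices discarded per
    set are added back. *)
Lemma sum_packing (cs : seq {set V}) t j : pairwise R cs -> 2 * k <= t * j ->
  \sum_(X <- cs) packing t e1 X <= n + 2 * j * size cs /\
  \sum_(X <- cs) packing t e2 X <= n + 2 * j * size cs.
Proof.
move=> Rcs tj.
have pad (e : rel V) cs' : \sum_(X <- cs') packing t e X <=
    \sum_(X <- cs') (packing t e X - 2 * j) + 2 * j * size cs'.
  rewrite [X in _ + X]mulnC -sum_seq_const -big_split /=.
  by apply: leq_sum => X _; lia.
split.
  have [|||s [us ss]] := @chain_path V e1 (fun X Y => R Y X) k t j _ _ k_gt0 tj (rev cs).
  - by move=> X Y /and4P[_ _]; rewrite disjoint_sym.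
  - move=> X Y A B /and4P[YU XU XY /forall_inP noE] AX BY kA kB.
    have [|||x [y [xA yB exy]]] := @pseudorandom A B _ _ _ kA kB.
    + exact: subset_trans XU.
    + exact: subset_trans YU.
    + by apply: disjointWl AX (disjointWr BY _); rewrite disjoint_sym.
    exists x, y; split=> //; move: exy.
    have /forall_inP/(_ x (subsetP AX _ xA)) := noE _ (subsetP BY _ yB).
    by case/andP=> _ /negPf->; rewrite orbF.
  - by rewrite pairwise_rev.
  rewrite (perm_big cs) ?perm_rev //= => sl.
  by have := leq_ltn_trans sl (no_path1 us ss); have := pad e1 cs; lia.
have [|||s [us ss]] := @chain_path V e2 R k t j _ _ k_gt0 tj cs.
- by move=> X Y /and4P[].
- move=> X Y A B /and4P[XU YU XY /forall_inP noE] AX BY kA kB.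
  have [|||x [y [xA yB exy]]] := @pseudorandom A B _ _ _ kA kB.
  + exact: subset_trans XU.
  + exact: subset_trans YU.
  + exact: disjointWl AX (disjointWr BY _).
  exists x, y; split=> //; move: exy.
  have /forall_inP/(_ y (subsetP BY _ yB)) := noE _ (subsetP AX _ xA).
  by case/andP=> /negPf->.
- by [].
move=> sl; have := leq_ltn_trans sl (no_path2 us ss); have := pad e2 cs; lia.
Qed.

Let loss t (X : {set V}) := 2 * k + 2 * (t * (packing t e1 X).+1) + 2 * (t * (packing t e2 X).+1).

Lemma refine_chain t (cs : seq {set V}) : 0 < t -> {in cs, forall X : {set V}, X \subset U} -> pairwise R cs ->
  exists cs' : seq {set V}, [/\ size cs' = 2 * size cs, pairwise R cs',
    {in cs', forall Y : {set V}, exists X : {set V}, [/\ X \in cs, Y \subset X & 2 * #|Y| <= #|X|]}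
    & \sum_(X <- cs) #|X| <= \sum_(Y <- cs') #|Y| + \sum_(X <- cs) loss t X].
Proof.
move=> t0; elim: cs => [|X cs IH] csU.
  by exists [::]; split=> //; rewrite !big_nil.
rewrite pairwise_cons => /andP[/allP RX Rcs].
have [|cs' [scs' Rcs' sub' sum']] := IH _ Rcs.
  by move=> Y Ycs; apply: csU; rewrite inE Ycs orbT.
have [||X1 [X2 [X1X X2X R12 [cX1 cX2] cX]]] :=
    @two_colour_split X (t * (packing t e1 X).+1) (t * (packing t e2 X).+1)
      (csU _ (mem_head _ _)).
- by move=> s /(dpath_packing t0) /ltnW.
- by move=> s /(dpath_packing t0) /ltnW.
exists [:: X1, X2 & cs']; split.
- by rewrite /= scs'; lia.
- have RX' (Z : {set V}) : Z \subset X -> {in cs', forall Y : {set V}, R Z Y}.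
    by move=> ZX Y /sub'[W [/RX RXW YW _]]; apply: R_sub RXW.
  rewrite !pairwise_cons /= R12 Rcs' andbT /=.
  by apply/andP; split; apply/allP; apply: RX'.
- move=> Y; rewrite !inE => /or3P[/eqP->|/eqP->|].
  + by exists X; rewrite mem_head.
  + by exists X; rewrite mem_head.
  + by case/sub'=> W [Wcs YW cY]; exists W; rewrite inE Wcs orbT.
- by rewrite !big_cons /loss; move: sum'; rewrite /loss; lia.
Qed.

(* Halving a set costs as many vertices as its longest paths, up to a factor  *)
(* t. By sum_packing this is O(t n) for a whole chain, and t ~ k / j with     *)
(* j = n / 2 ^ i is bounded for all but the last few levels i; so the total   *)
(* cost is O(n log n) whatever the ratio k / log n.                           *)
Lemma chain_levels lam i : n = 2 ^ lam -> i <= lam ->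
  exists cs : seq {set V}, [/\ size cs = 2 ^ i, pairwise R cs,
    {in cs, forall X : {set V}, X \subset U /\ #|X| * 2 ^ i <= #|U|}
    & #|U| <= \sum_(X <- cs) #|X| + (34 * (k * 2 ^ i) + 32 * (i * n))].
Proof.
move=> nE; elim: i => [_|i IH il].
  exists [:: U]; split=> //; last by rewrite big_seq1; lia.
  by move=> X; rewrite inE => /eqP->; rewrite muln1.
have [cs [scs Rcs csU sumcs]] := IH (ltnW il).
pose j := 2 ^ (lam - i); pose t := 2 * (k %/ j).+1.
have jm : j * 2 ^ i = n by rewrite -expnD subnK // ltnW.
have j0 : 0 < j by rewrite expn_gt0.
have tj : 2 * k <= t * j.
  by rewrite /t -mulnA leq_mul2l /= ltnW // ltn_ceil.
have [|cs' [scs' Rcs' sub' sum']] := @refine_chain t cs isT _ Rcs.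
  by move=> X /csU[].
exists cs'; split=> //.
- by rewrite scs' scs expnS.
- move=> Y /sub'[X [/csU[XU cX] YX cY]]; split; first exact: subset_trans XU.
  by apply: leq_trans cX; rewrite expnS mulnA leq_mul2r mulnC cY orbT.
have [s1 s2] := sum_packing Rcs tj; rewrite scs -mulnA jm in s1 s2.
have lossE : \sum_(X <- cs) loss t X = 2 * (k * 2 ^ i) +
  2 * (t * (\sum_(X <- cs) packing t e1 X + 2 ^ i)) +
  2 * (t * (\sum_(X <- cs) packing t e2 X + 2 ^ i)).
  have sumS (f : {set V} -> nat) : \sum_(X <- cs) (f X).+1 = \sum_(X <- cs) f X + 2 ^ i.
    by under eq_bigr do rewrite -addn1; rewrite big_split sum_seq_const scs muln1.
  by rewrite /loss 2!big_split /= sum_seq_const scs -!big_distrr /= !sumS; lia.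
have mn : 2 ^ i <= n by rewrite -jm leq_pmull.
have tn : t * n <= 2 * (k * 2 ^ i + n).
  rewrite /t -mulnA leq_mul2l /= mulSn addnC leq_add2r -jm mulnA.
  by rewrite leq_mul2r leq_trunc_div orbT.
have t1 : t * (\sum_(X <- cs) packing t e1 X + 2 ^ i) <= t * (4 * n).
  by rewrite leq_mul2l; lia.
have t2 : t * (\sum_(X <- cs) packing t e2 X + 2 ^ i) <= t * (4 * n).
  by rewrite leq_mul2l; lia.
(* With [m = 2 ^ i], this round costs at most [2 k m + 16 t n <= 34 k m + 32 n]. The first term
   doubles from round to round, so all rounds together stay below [34 k * 2 ^ i.+1] in that term. *)
rewrite lossE in sum'; rewrite expnS; move: t1 t2.
by rewrite mulnCA; lia.
Qed.

(** After the deletions of [packing_remove] in both colours, Gallai-Roy applied to [e1] and then to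
    [e2] leaves a set independent in both, hence at most one vertex. *)
Lemma card_packing (X : {set V}) t : X \subset U -> 0 < t ->
  #|X| <= packing t e1 X * packing t e2 X
          + t * (packing t e1 X).+1 + t * (packing t e2 X).+1.
Proof.
move=> XU t0; have [Y [YX cX noY]] := packing_remove e1 X t0.
have [Z [ZX cX' noZ]] := packing_remove e2 X t0.
have [|W [WYZ cYZ] indW] := @large_independent_set V e1 (Y :&: Z) (packing t e1 X).
  by move=> s sP; apply: noY; apply: dpath_sub sP; apply: subsetIl.
have [|W' [W'W cW] indW'] := @large_independent_set V e2 W (packing t e2 X).
  move=> s sP; apply: noZ; apply: dpath_sub sP.
  exact: subset_trans WYZ (subsetIr _ _).
have W'1 : #|W'| <= 1.
  rewrite leqNgt; apply/negP => /card_gt1P[x [y [xW' yW' xy]]].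
  have xW := subsetP W'W _ xW'; have yW := subsetP W'W _ yW'.
  have WU := subset_trans WYZ (subset_trans (subsetIl _ _) (subset_trans YX XU)).
  have := semicomplete (subsetP WU _ xW) (subsetP WU _ yW) xy.
  rewrite (negPf (indW _ _ xW yW xy)) (negPf (indW' _ _ xW' yW' xy)).
  by rewrite eq_sym in xy; rewrite (negPf (indW _ _ yW xW xy)) (negPf (indW' _ _ yW' xW' xy)).
have cI : #|Y| + #|Z| <= #|X| + #|Y :&: Z|.
  by rewrite -cardsUI leq_add2r subset_leq_card // subUset YX.
have W1 : #|W| <= packing t e2 X by apply: leq_trans cW _; rewrite -[leqRHS]muln1 leq_mul2l W'1 orbT.
have : #|Y :&: Z| <= packing t e1 X * packing t e2 X.
  by apply: leq_trans cYZ _; rewrite leq_mul2l W1 orbT.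
by lia.
Qed.

(** The ratio [Q] of [k] to [log n] may grow up to about [lam / 3] without affecting the
    constant. *)
Lemma two_colour_ramsey lam Q : n = 2 ^ lam -> 3 * Q.+1 <= lam -> k <= Q * lam ->
  #|U| < 2000 * n * lam.
Proof.
move=> nE Qlam kQ; have lam0 : 0 < lam by lia.
(* The refinement stops at [m = n / K] sets, where [K = 2 ^ kap] lies between [lam] and
   [2 * lam]. *)
pose kap := up_log 2 lam.
have lamK : lam <= 2 ^ kap by apply: up_logP.
have Klam : 2 ^ kap <= 2 * lam.
  rewrite /kap; case: (ltngtP lam 1) => [|lam1|->//]; first by lia.
  have := @up_log_gtn 2 lam isT lam1; have : 0 < up_log 2 lam by rewrite up_log_gt0.
  by case: (up_log 2 lam) => // m _ /=; rewrite expnS; lia.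
have kaplam : kap <= lam.
  by apply: up_log_min => //; apply: ltnW; apply: ltn_expl.
have [cs [scs Rcs csU cU]] := chain_levels nE (leq_subr kap lam).
pose m := 2 ^ (lam - kap); pose K := 2 ^ kap; pose t := 2 * (k %/ K).+1.
have Km : K * m = n by rewrite -expnD subnKC.
have K0 : 0 < K by rewrite expn_gt0.
have m0 : 0 < m by rewrite expn_gt0.
have tK : 2 * k <= t * K.
  by rewrite /t -mulnA leq_mul2l /= ltnW // ltn_ceil.
have [s1 s2] := sum_packing Rcs tK.
rewrite scs -mulnA Km in s1 s2.
pose G := 576 * (K * K) + 50 * (t * K).
(* If both packings are at most [24 * K], then [#|X| <= G] by [card_packing]. Otherwise
   [#|X| <= #|U| / m] is charged to the packings; as these sum to at most [6 * n], such sets cover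
   at most a quarter of [U]. *)
have ptwise X : X \in cs -> 24 * n * #|X| <=
    #|U| * (packing t e1 X + packing t e2 X) + 24 * n * G.
  move=> /csU[XU cX]; have := card_packing XU (isT : 0 < t).
  move: (packing t e1 X) (packing t e2 X) => a b.
  have [aK|aK] := leqP a (24 * K); last first.
    move=> _; apply: (leq_trans (n := #|U| * (24 * K))); last by nia.
    by rewrite -Km; move: cX; rewrite -/m; nia.
  have [bK|bK] := leqP b (24 * K); last first.
    move=> _; apply: (leq_trans (n := #|U| * (24 * K))); last by nia.
    by rewrite -Km; move: cX; rewrite -/m; nia.
  move=> cab; suff : #|X| <= G by nia.
  have : a * b <= (24 * K) * (24 * K) by apply: leq_mul.
  have : t * a.+1 <= t * (25 * K) by rewrite leq_mul2l; lia.
  have : t * b.+1 <= t * (25 * K) by rewrite leq_mul2l; lia.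
  by rewrite /G; lia.
have sumX : 24 * n * (\sum_(X <- cs) #|X|) <= #|U| * (6 * n) + m * (24 * n * G).
  rewrite big_distrr /=.
  apply: (@leq_trans (\sum_(X <- cs)
    (#|U| * (packing t e1 X + packing t e2 X) + 24 * n * G))).
    by rewrite big_seq [leqRHS]big_seq; apply: leq_sum.
  rewrite big_split /= sum_seq_const scs leq_add2r -big_distrr leq_mul2l big_split /=.
  by apply/orP; right; lia.
have n0 : 0 < n by rewrite nE expn_gt0.
have sumX' : 4 * (\sum_(X <- cs) #|X|) <= #|U| + 4 * (m * G).
  by rewrite -(leq_pmul2l n0); lia.
have mG : m * G = n * (576 * K + 50 * t) by rewrite -Km /G; lia.
have km : k * m <= Q * n.
  rewrite -Km mulnA leq_mul2r (leq_trans kQ) ?orbT // leq_mul2l lamK orbT //.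
have tQ : t <= 2 * Q.+1.
  rewrite /t leq_mul2l ltnS /= -ltnS ltn_divLR //.
  have QK : Q * lam <= Q * K by rewrite leq_mul2l lamK orbT.
  by apply: leq_ltn_trans (leq_trans kQ QK) _; rewrite mulSn; lia.
have b1 : n * (576 * K + 50 * t) <= n * (1152 * lam + 100 * Q.+1).
  by rewrite leq_mul2l; move: Klam; rewrite -/K; lia.
have b2 : (lam - kap) * n <= lam * n by rewrite leq_mul2r leq_subr orbT.
have b3 : n * (3 * Q.+1) <= n * lam by rewrite leq_mul2l Qlam orbT.
have nlam : 0 < n * lam by rewrite muln_gt0 n0.
move: cU km b1 b2 b3 nlam sumX'; rewrite -/m mG.
move: (\sum_(X <- cs) _) (k * m) ((lam - kap) * n) => S u v.
by move: (#|U|) => w; clear; lia.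
Qed.
End TwoColours.

(** * Pseudorandom tournaments *)

(** Each colour costs a factor [n], by [large_independent_set]. *)
Lemma avoid_colours (V : finType) (e : nat -> rel V) p n :
    (forall i s, i < p -> uniq s -> sorted (e i) s -> size s <= n) ->
  exists2 U : {set V}, #|V| <= n ^ p * #|U| &
    forall i, i < p -> {in U &, forall x y, x != y -> ~~ e i x y}.
Proof.
elim: p => [_|p IH noP]; first by exists [set: V]; rewrite ?cardsT ?mul1n.
have [i s ip|U cU HU] := IH; first by apply: noP; apply: ltnW.
have [|W [WU cW] HW] := @large_independent_set V (e p) U n.
  by move=> s /and3P[us ss _]; apply: (noP p).
exists W; first by apply: leq_trans cU _; rewrite expnSr -mulnA leq_mul2l cW orbT.
move=> i; rewrite ltnS leq_eqVlt => /orP[/eqP->//|ip] x y xW yW.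
exact: HU ip x y (subsetP WU _ xW) (subsetP WU _ yW).
Qed.

(** Sets of size exactly [k] suit the union bound, and [pseudorandomP] passes to larger ones. As [A]
    and [B] can be exchanged, edges exist in both directions. *)
Definition pseudorandom (V : finType) k (E : {set V * V}) :=
  [forall A : {set V}, forall B : {set V},
    [&& #|A| == k, #|B| == k & [disjoint A & B]] ==>
    [exists x in A, exists y in B, (x, y) \in E]].

Lemma pseudorandomP (V : finType) k (E : {set V * V}) (A B : {set V}) :
  pseudorandom k E -> [disjoint A & B] -> k <= #|A| -> k <= #|B| ->
  exists x y, [/\ x \in A, y \in B & (x, y) \in E].
Proof.
have sub (X : {set V}) : k <= #|X| -> exists2 Y : {set V}, Y \subset X & #|Y| == k.
  rewrite cardE => kX; exists [set x in take k (enum X)].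
    by apply/subsetP => x; rewrite inE => /mem_take; rewrite mem_enum.
  by rewrite cardsE (card_uniqP _) ?take_uniq ?enum_uniq // size_takel.
move=> psE AB /sub[A' A'A cA'] /sub[B' B'B cB'].
move/forallP/(_ A')/forallP/(_ B'): psE; rewrite cA' cB'.
rewrite (disjointWl A'A (disjointWr B'B AB)) => /exists_inP[x xA /exists_inP[y yB xy]].
by exists x, y; split; [apply: (subsetP A'A) | apply: (subsetP B'B) |].
Qed.

(* The first q - 1 colours are removed by avoid_colours, leaving two colours  *)
(* on a set of |V| / n ^ q.-1 vertices.                                       *)
Lemma pseudorandom_arrows (V : finType) (E : {set V * V}) n q lam Q k :
  tournament E -> pseudorandom k E -> 0 < q -> 0 < k ->
  n <= 2 ^ lam <= 2 * n -> 3 * Q.+1 <= lam -> k <= Q * lam ->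
  4000 * n ^ q * lam <= #|V| -> arrows E n q.+1.
Proof.
move=> /andP[_ /forallP total] psE q0 k0 /andP[nlam lamn] Qlam kQ bigV.
apply/forallP => c; apply: contraT => noP.
have short i s : uniq s -> sorted (mono_edge E c i) s -> size s < n.
  move=> us ss; rewrite ltnNge; apply: contra noP => ns.
  apply/existsP; exists i; apply/existsP.
  have st : size (take n s) == n by rewrite size_takel.
  by exists (Tuple st); rewrite /= take_uniq // take_sorted.
have [i s _ us ss|U cU HU] := @avoid_colours V (fun i => mono_edge E c (inord i)) q.-1 n.
  exact: ltnW (short _ _ us ss).
(* Colours below [q.-1] do not occur inside [U], so an edge there has one of the two last
   colours. *)
have adj x y : x \in U -> y \in U -> x != y -> (x, y) \in E ->
    mono_edge E c (inord q.-1) x y || mono_edge E c (inord q) x y.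
  move=> xU yU xy Exy; rewrite /mono_edge Exy /=.
  have := ltn_ord (c (x, y)); rewrite ltnS leq_eqVlt => /orP[/eqP cq|cq].
    by apply/orP; right; apply/eqP/val_inj; rewrite /= inordK.
  apply/orP; left; apply/eqP/val_inj; rewrite /= inordK; last by lia.
  apply/eqP; rewrite eqn_leq; apply/andP; split; first by rewrite -ltnS prednK.
  rewrite leqNgt; apply/negP => /HU/(_ x y xU yU xy).
  by rewrite /mono_edge Exy inord_val eqxx.
have := @two_colour_ramsey V (mono_edge E c (inord q.-1)) (mono_edge E c (inord q))
  U k k0 _ _ (2 ^ lam) _ _ lam Q erefl Qlam kQ.
have -> : (#|U| < 2000 * 2 ^ lam * lam) = false.
  apply/negP => Ulam; have n0 : 0 < n by have := expn_gt0 2 lam; lia.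
  have : n ^ q.-1 * #|U| < 4000 * n ^ q * lam.
    rewrite -{2}(prednK q0) expnS mulnA mulnAC [leqRHS]mulnC ltn_pmul2l ?expn_gt0 ?n0 //.
    apply: leq_trans Ulam _; rewrite leq_mul2r; apply/orP; right; lia.
  by lia.
case/(_ _ _ _ _)/notF.
- move=> x y xU yU xy; move/forallP/(_ y): (total x); rewrite xy /=.
  case/orP => [/(adj _ _ xU yU xy)|]; first by case/orP => ->; rewrite ?orbT.
  by rewrite eq_sym in xy; move=> /(adj _ _ yU xU xy); case/orP => ->; rewrite ?orbT.
- move=> A B AU BU AB kA kB; have [x [y [xA yB xy]]] := pseudorandomP psE AB kA kB.
  exists x, y; split=> //; apply: adj => //; [exact: (subsetP AU) | exact: (subsetP BU) |].
  by apply: contraTneq xA => ->; rewrite (disjointFl AB yB).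
- by move=> s us ss; apply: leq_trans nlam; apply: short ss.
- by move=> s us ss; apply: leq_trans nlam; apply: short ss.
Qed.

(** * Counting tournaments *)

Lemma tournamentP (V : finType) (T : {set V * V}) :
  reflect (forall x y, ((x, y) \in T) = (x != y) && ((y, x) \notin T)) (tournament T).
Proof.
apply: (iffP andP) => [[/forallP or /forallP to] x y|H].
  have orxy u v := implyP (forallP (or u) v).
  case: eqVneq => [<-|xy] /=.
    by apply/negP => xx; move: (orxy x x xx); rewrite xx.
  apply/idP/idP => [/orxy//|yx]; move/forallP/(_ y): (to x).
  by rewrite xy (negPf yx) orbF.
split; apply/forallP => x; apply/forallP => y; apply/implyP; rewrite (H x y).
  by case/andP.
by move=> ->; rewrite orNb.
Qed.

Lemma ffact_leq_exp n k : n ^_ k <= n ^ k.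
Proof. by elim: k => // k IH; rewrite ffactnSr expnSr leq_mul // leq_subr. Qed.

Section CountTournaments.
Variable N : nat.
Implicit Types (T S : {set 'I_N * 'I_N}) (A B : {set 'I_N}).

Let Lt : {set 'I_N * 'I_N} := [set p : 'I_N * 'I_N | p.1 < p.2].

Lemma card_tournaments : #|[set T : {set 'I_N * 'I_N} | tournament T]| = 2 ^ #|Lt|.
Proof.
rewrite -card_powerset.
(* [S] prescribes which pairs are oriented upwards; the others are reversed. *)
pose g S : {set 'I_N * 'I_N} := [set p : 'I_N * 'I_N | if p.1 < p.2 then p \in S else
  (p.2 < p.1) && ((p.2, p.1) \notin S)].
have inj : {in powerset Lt &, injective g}.
  move=> S S'; rewrite !inE => /subsetP SL /subsetP S'L gE; apply/setP => -[x y].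
  have := congr1 (fun T => (x, y) \in T) gE; rewrite !inE /=; case: ifP => // xy _.
  by apply/idP/idP => [/SL|/S'L]; rewrite inE /= xy.
rewrite -(card_in_imset inj); apply/eq_card => T; apply/idP/idP; rewrite inE.
  move=> /tournamentP tT; apply/imsetP; exists (T :&: Lt).
    by rewrite inE subsetIr.
  apply/setP => -[x y]; have := tT x y; rewrite !inE /=.
  by rewrite -(inj_eq val_inj) /=; case: (ltngtP x y) => //= xy; rewrite ?andbT.
case/imsetP => S _ ->; apply/tournamentP => x y; rewrite -(inj_eq val_inj) /= !inE /=.
by case: (ltngtP x y) => //=; rewrite ?negbK.
Qed.

(* Reversing any set of pairs of A x B turns a tournament without edges from  *)
(* A to B into another tournament, injectively.                               *)
Lemma card_no_edges A B : [disjoint A & B] ->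
  #|[set T : {set 'I_N * 'I_N} | tournament T & [forall x in A, forall y in B, (x, y) \notin T]]|
    * 2 ^ (#|A| * #|B|) <= #|[set T : {set 'I_N * 'I_N} | tournament T]|.
Proof.
move=> AB; set bad := [set T | _ & _].
rewrite -cardsX -card_powerset -cardsX.
pose flip (TS : {set 'I_N * 'I_N} * {set 'I_N * 'I_N}) :=
  [set p : 'I_N * 'I_N | if p \in setX A B then p \in TS.2 else
           if (p.2, p.1) \in setX A B then (p.2, p.1) \notin TS.2 else p \in TS.1].
have AnB x : x \in A -> x \notin B by move=> xA; rewrite (disjointFr AB).
have badP T : T \in bad -> tournament T /\ {in setX A B, forall p, p \notin T}.
  rewrite inE => /andP[tT /forall_inP noE]; split=> // -[x y].
  by rewrite inE => /andP[/= xA yB]; apply: (forall_inP (noE _ xA)).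
have inj : {in setX bad (powerset (setX A B)) &, injective flip}.
  move=> [T S] [T' S'] /setXP[/= /badP[/tournamentP tT T0] SAB].
  move=> /setXP[/= /badP[/tournamentP tT' T'0] S'AB] fE.
  have fp p : (p \in flip (T, S)) = (p \in flip (T', S')) by rewrite fE.
  rewrite !powersetE in SAB S'AB.
  congr pair; apply/setP => -[x y]; have := fp (x, y); rewrite !inE /=.
    case: ifP => [xy _|xy].
      by rewrite (negPf (T0 _ _)) ?(negPf (T'0 _ _)) ?inE.
    case: ifP => // yx _; have := tT x y; have := tT' x y.
    by move=> -> ->; rewrite (T0 (y, x)) ?(T'0 (y, x)) ?inE.
  case: ifP => // xy _; apply/idP/idP => [/(subsetP SAB)|/(subsetP S'AB)];
  by rewrite inE /= xy.
rewrite -(card_in_imset inj); apply/subset_leq_card/subsetP => T'.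
case/imsetP => -[T S] /setXP[/= /badP[/tournamentP tT _] _] ->.
rewrite inE; apply/tournamentP => x y; rewrite !inE /=.
case: (boolP ((x \in A) && _)) => /= [/andP[xA yB]|_].
  have yA : (y \in A) = false by apply: contraTF yB => /AnB.
  have -> : x != y by apply: contraTneq xA => ->; rewrite yA.
  by rewrite yA negbK.
case: (boolP ((y \in A) && _)) => /= [/andP[yA xB]|_]; last exact: tT.
by have -> : x != y by apply: contraTneq xB => ->; apply: AnB.
Qed.

(** Union bound: there are at most [2 ^ (2 * l * k)] pairs of [k]-sets, each bad with probability at
    most [2 ^ - (k * k)]. For [k = 2 * l + 1] the product is [2 ^ - k]. *)
Lemma card_not_pseudorandom l : N <= 2 ^ l ->
  #|[set T : {set 'I_N * 'I_N} | tournament T & ~~ pseudorandom (2 * l).+1 T]| * 2 ^ (2 * l).+1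
    <= #|[set T : {set 'I_N * 'I_N} | tournament T]|.
Proof.
move=> Nl; set k := (2 * l).+1; set t := #|[set T : {set 'I_N * 'I_N} | tournament T]|.
pose pairs := [set AB : {set 'I_N} * {set 'I_N} |
  [&& #|AB.1| == k, #|AB.2| == k & [disjoint AB.1 & AB.2]]].
pose bad (AB : {set 'I_N} * {set 'I_N}) := [set T : {set 'I_N * 'I_N} | tournament T &
  [forall x in AB.1, forall y in AB.2, (x, y) \notin T]].
have sub : [set T : {set 'I_N * 'I_N} | tournament T & ~~ pseudorandom k T] \subset \bigcup_(AB in pairs) bad AB.
  apply/subsetP => T; rewrite inE => /andP[tT]; rewrite negb_forall.
  case/existsP => A; rewrite negb_forall => /existsP[B]; rewrite negb_imply.
  case/andP => AB; rewrite negb_exists_in => noE; apply/bigcupP; exists (A, B).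
    by rewrite inE.
  rewrite inE tT; apply/forall_inP => x xA; move/forall_inP/(_ x xA): noE.
  by rewrite negb_exists_in.
have cpairs : #|pairs| <= N ^ k * N ^ k.
  apply: (@leq_trans #|setX [set A : {set 'I_N} | #|A| == k] [set A : {set 'I_N} | #|A| == k]|).
    by apply/subset_leq_card/subsetP => -[A B]; rewrite !inE => /and3P[-> ->].
  rewrite cardsX card_draws card_ord; apply: leq_mul;
  by apply: leq_trans (ffact_leq_exp _ _); rewrite -bin_ffact leq_pmulr ?fact_gt0.
have cbad AB : AB \in pairs -> #|bad AB| * 2 ^ (k * k) <= t.
  rewrite inE => /and3P[/eqP cA /eqP cB dAB].
  by have := card_no_edges dAB; rewrite cA cB.
rewrite -(@leq_pmul2r (2 ^ (2 * l * k))) ?expn_gt0 // -mulnA -expnD -mulSn.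
apply: (@leq_trans (\sum_(AB in pairs) #|bad AB| * 2 ^ (k * k))).
  rewrite -big_distrl leq_mul2r /=; apply/orP; right.
  apply: leq_trans (subset_leq_card sub) _.
  apply: (big_ind2 (fun (X : {set {set 'I_N * 'I_N}}) m => #|X| <= m)) => //.
    by rewrite cards0.
  by move=> X m Y m' Xm Ym; apply: leq_trans (leq_card_setU _ _) (leq_add Xm Ym).
apply: (@leq_trans (\sum_(AB in pairs) t)); first exact: leq_sum.
rewrite sum_nat_const mulnC leq_mul2l; apply/orP; right.
apply: leq_trans cpairs _; rewrite -expnD addnn -mul2n.
have -> : 2 * l * k = l * (2 * k) by rewrite mulnA [l * 2]mulnC.
by rewrite [2 ^ _]expnM leq_exp2r.
Qed.

End CountTournaments.

(** * Asymptotics *)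

Definition log_len n := (trunc_log 2 n).+1.

(* The constant must not depend on q: 4000 = 2 * 2000, since two_colour_ramsey *)
(* is applied to 2 ^ log_len n <= 2 n.                                        *)
Definition host_order q n := (4000 * n ^ q * log_len n)%N.

Lemma log_len_bounds n : (0 < n)%N -> (n < 2 ^ log_len n <= 2 * n)%N.
Proof.
by move=> n0; rewrite trunc_log_ltn // expnS leq_mul2l trunc_logP.
Qed.

Lemma card_not_arrows n q : (0 < q)%N -> (0 < n)%N -> (6 * q + 25 <= log_len n)%N ->
  (#|[set T : {set 'I_(host_order q n) * 'I_(host_order q n)} |
      tournament T & ~~ arrows T n q.+1]| * n.+1
    <= #|[set T : {set 'I_(host_order q n) * 'I_(host_order q n)} | tournament T]|)%N.
Proof.
move=> q0 n0 lamq; set N := host_order q n; set lam := log_len n in lamq *.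
have /andP[nlam lamn] := log_len_bounds n0; rewrite -/lam in nlam lamn.
(* [4000 <= 2 ^ 12], [n ^ q <= 2 ^ (lam * q)] and [lam <= 2 ^ lam]. *)
pose l := (12 + lam * q.+1)%N.
have Nl : (N <= 2 ^ l)%N.
  rewrite /N /host_order -/lam /l expnD mulnS -mulnA; apply: leq_mul => //.
  rewrite expnD [leqRHS]mulnC; apply: leq_mul; last exact/ltnW/ltn_expl.
  by rewrite expnM leq_exp2r // ltnW.
apply: leq_trans (card_not_pseudorandom Nl); apply: leq_mul; last first.
  apply: leq_trans nlam _; apply: leq_pexp2l => //; rewrite /l.
  by have := leq_pmulr lam (ltn0Sn q); lia.
apply/subset_leq_card/subsetP => T; rewrite !inE => /andP[tT]; rewrite tT /=.
(* The choice [Q = 2 * q + 3] gives [k = 2 * lam * (q + 1) + 25 <= Q * lam] once [25 <= lam], and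
   [3 * Q.+1 = 6 * q + 12]; both follow from [6 * q + 25 <= lam]. *)
apply: contra => psT; apply: (@pseudorandom_arrows _ T n q lam (2 * q + 3) _ tT psT) => //.
- by rewrite ltnW.
- by lia.
- by rewrite /l; nia.
- by rewrite card_ord.
Qed.

Lemma tournaments_gt0 N : (0 < #|[set T : {set 'I_N * 'I_N} | tournament T]|)%N.
Proof. by rewrite card_tournaments expn_gt0. Qed.

Lemma size_ramsey_le n q : (0 < q)%N -> (0 < n)%N -> (6 * q + 25 <= log_len n)%N ->
  (size_ramsey n q.+1 <= host_order q n ^ 2)%N.
Proof.
move=> q0 n0 lamq; have := card_not_arrows q0 n0 lamq.
set N := host_order q n => bad.
(* Not all tournaments can be bad, since the bad ones make up at most a fraction [1 / (n + 1)]. *)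
have [T /andP[tT aT]] : exists T : {set 'I_N * 'I_N}, tournament T && arrows T n q.+1.
  apply/existsP; apply: contraTT bad; rewrite negb_exists -ltnNge => /forallP noT.
  have -> : [set T : {set 'I_N * 'I_N} | tournament T & ~~ arrows T n q.+1]
      = [set T | tournament T].
    apply/setP => T; rewrite !inE; have := noT T.
    by case: (tournament T).
  by rewrite ltn_Pmulr ?tournaments_gt0.
rewrite /size_ramsey; case: ex_minnP => m _ /(_ #|T|) minm.
apply: (@leq_trans #|T|).
  apply: minm; apply/asboolP; exists 'I_N, T; split=> //.
  by case/andP: tT.
by apply: leq_trans (max_card _) _; rewrite card_prod card_ord.
Qed.

Local Open Scope classical_set_scope.
Local Open Scope ring_scope.

Lemma tournament_probE (R : realType) N (P : {set 'I_N * 'I_N} -> bool) :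
  tournament_prob R P =
    #|finset (fun T => tournament T && P T)|%:R / #|finset (@tournament 'I_N)|%:R.
Proof.
rewrite /tournament_prob card_tournaments -sum1_card natr_sum mulr_suml.
rewrite [RHS](eq_bigl (fun T => tournament T && P T)) => [|T]; last by rewrite inE.
apply: eq_bigr => T _; rewrite (eq_bigl (mem (finset (fun p : 'I_N * 'I_N => (p.1 < p.2)%N)))).
  by rewrite prodr_const natrX expr_div_n expr1n.
by move=> p; rewrite /= inE.
Qed.

Lemma tournament_prob_arrows (R : realType) n q :
  (0 < q)%N -> (0 < n)%N -> (6 * q + 25 <= log_len n)%N ->
  1 - n.+1%:R^-1 <= tournament_prob R
    (fun T : {set 'I_(host_order q n) * 'I_(host_order q n)} => arrows T n q.+1) <= 1.
Proof.
move=> q0 n0 lamq; rewrite tournament_probE; have := card_not_arrows q0 n0 lamq.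
have := tournaments_gt0 (host_order q n).
set t := #|_|; set b := #|_|; set a := #|_| => t0 bt.
have abt : (a + b = t)%N.
  rewrite /a /b /t -(cardsID (finset (fun T => arrows T n q.+1)) (finset (@tournament _))).
  congr (_ + _)%N; apply: eq_card => T; rewrite !inE //.
  by rewrite andbC.
have t0' : 0 < t%:R :> R by rewrite ltr0n.
rewrite ler_pdivlMr // ler_pdivrMr // mul1r ler_nat.
have -> : (a <= t)%N by rewrite -abt leq_addr.
rewrite andbT mulrBl mul1r lerBlDr -{1}abt natrD lerD2l ler_pdivlMl ?ltr0n //.
by rewrite -natrM ler_nat mulnC.
Qed.

Lemma log_len_log2 (R : realType) n : (1 < n)%N ->
  (log_len n)%:R - 1 <= log2 (n%:R : R) <= (log_len n)%:R.
Proof.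
move=> n1; have n0 : (0 < n)%N by apply: ltnW.
have /andP[nlam _] := log_len_bounds n0.
have ln2 : 0 < ln 2 :> R by rewrite ln_gt0 // ltr1n.
rewrite /log2 ler_pdivlMr // ler_pdivrMr //.
have lnX m : m%:R * ln 2 = ln ((2 ^ m)%N%:R) :> R.
  by rewrite natrX lnXn ?ltr0n // mulr_natl.
have -> : (log_len n)%:R - 1 = (trunc_log 2 n)%:R :> R by rewrite /log_len -natr1 addrK.
by rewrite !lnX !ler_ln ?posrE ?ltr0n ?expn_gt0 // !ler_nat trunc_logP //= ltnW.
Qed.

Lemma log_len_large m : \forall n \near \oo, (m <= log_len n)%N.
Proof.
near=> n; rewrite /log_len ltnW // ltnS -[leqLHS](@trunc_expnK 2) //.
apply: leq_trunc_log; near: n; exact: nbhs_infty_ge.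
Unshelve. all: by end_near. Qed.

Lemma host_order_theta (R : realType) n q : (1 < n)%N ->
  4000%:R * (n%:R ^+ q * log2 n%:R) <= (host_order q n)%:R :> R /\
  (host_order q n)%:R <= 8000%:R * (n%:R ^+ q * log2 n%:R) :> R.
Proof.
move=> n1; have /andP[le_log log_le] := log_len_log2 R n1.
have log1 : 1 <= log2 (n%:R : R).
  apply: le_trans le_log; rewrite lerBrDr -(natrD _ 1 1) ler_nat ltnS.
  by rewrite trunc_log_gt0.
have nq : 0 <= n%:R ^+ q :> R by rewrite exprn_ge0.
rewrite /host_order !natrM natrX -mulrA; split.
  by rewrite ler_pM2l ?ltr0n // ler_wpM2l.
(* [log_len n] is at most [log2 n + 1], hence at most [2 * log2 n]. *)
rewrite (_ : 8000%N = (4000 * 2)%N) // natrM -!mulrA ler_pM2l ?ltr0n //.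
by rewrite mulrCA ler_wpM2l //; lra.
Qed.

Theorem theorem2 (R : realType) :
  exists c2 : R, forall q : nat, (1 <= q)%N ->
    (\forall n \near \oo,
       (size_ramsey n q.+1)%:R
         <= c2 * n%:R ^+ (2 * q) * log2 (n%:R : R) ^+ 2) /\
    (exists N : nat -> nat,
       (fun n => (N n)%:R : R^o)
         =Theta_\oo (fun n => n%:R ^+ q * log2 (n%:R : R) : R^o) /\
       tournament_prob R (fun T : {set 'I_(N n) * 'I_(N n)} =>
         arrows T n q.+1) @[n --> \oo] --> (1 : R)).
Proof.
(* A host tournament has at most [host_order q n ^ 2] edges, whence the square. *)
exists (8000%:R ^+ 2) => q q1; split.
  near=> n.
  have n1 : (1 < n)%N by near: n; exact: nbhs_infty_gt.
  have lamq : (6 * q + 25 <= log_len n)%N by near: n; exact: log_len_large.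
  have [_ hi] := host_order_theta R q n1.
  apply: (@le_trans _ _ ((host_order q n)%:R ^+ 2)).
    by rewrite -natrX ler_nat size_ramsey_le // ltnW.
  rewrite mulnC exprM -!exprMn -mulrA; apply: lerXn2r => //.
  + by rewrite nnegrE.
  + by rewrite nnegrE (le_trans _ hi).
exists (host_order q); split.
  rewrite eqThetaE qualifE; apply/asboolP.
  exists (4000%:R, 8000%:R); first by rewrite /= !ltr0n.
  near=> n; have n1 : (1 < n)%N by near: n; exact: nbhs_infty_gt.
  have [lo hi] := host_order_theta R q n1.
  have g0 : 0 <= n%:R ^+ q * log2 n%:R :> R.
    by rewrite -(pmulr_rge0 _ (_ : 0 < 8000%:R)) ?ltr0n // (le_trans _ hi).
  by rewrite /= !ger0_norm.
apply: (@squeeze_cvgr _ _ _ R (fun n => 1 - harmonic n) (fun=> 1)).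
- near=> n; apply: tournament_prob_arrows => //.
    by near: n; exact: nbhs_infty_gt.
  by near: n; exact: log_len_large.
- rewrite -[X in _ --> X]subr0; apply: cvgB; first exact: cvg_cst.
  exact: cvg_harmonic.
- exact: cvg_cst.
Unshelve. all: by end_near. Qed.
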